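(* Let $p$ be a prime and $n\ge 1$ an integer. Let $$d=p^t+p+1,\qquad t=\begin{cases}\frac{n-1}{2} & (n \text{ odd}),\\[2pt] \frac{n}{2} & (n\text{ even}).\end{cases}$$ Then $f_d\colon\mathbb{F}_{p^n}\to\mathbb{F}_{p^n}$, $f_d(x)=x^d$, is a GAPN function on $\mathbb{F}_{p^n}$ if and only if either $p=2$ and $n$ is odd, or $p=3$.
   Context: A function $f\colon \mathbb{F}_{p^n}\to\mathbb{F}_{p^n}$ is a generalized almost perfect nonlinear (GAPN) function if for all $a\in \mathbb{F}_{p^n}^\times$ and $b\in \mathbb{F}_{p^n}$, $$\#\Big\{x\in \mathbb{F}_{p^n} : \sum_{i\in\mathbb{F}_p} f(x+ia)=b\Big\}\le p.$$ For $p=2$ this coincides with the notion of an almost perfect nonlinear (APN) function.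
   Formalization: The case n = 1 with p ≥ 5 is excluded, because there every function on F_p is trivially GAPN (a subset of F_p has at most p elements), so the ''only if'' direction fails as stated. *)

(* Defs.v *)
From mathcomp Require Import all_boot all_order all_algebra all_field.
Set Implicit Arguments.
Unset Strict Implicit.
Unset Printing Implicit Defensive.
Import GRing.Theory.
Local Open Scope ring_scope.

(* For p prime and F a field with p ^ n elements, F has characteristic p and
   the prime field embeds in F by i |-> (i : nat)%:R.  When #|F| = p the bound
   is vacuous: every function is GAPN. *)
Definition GAPN (p : nat) (F : finFieldType) (f : F -> F) : Prop :=
  forall a b : F, a != 0 ->
    leq #|[set x : F | \sum_(i : 'F_p) f (x + (i : nat)%:R * a) == b]| p.

Definition half_exp (n : nat) : nat := if odd n then ((n - 1) %/ 2)%N else (n %/ 2)%N.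

(* Main.v *)
Require Import Defs.
From mathcomp Require Import all_boot all_order all_algebra all_field.
From mathcomp Require Import ring.

(** By homogeneity it suffices to take [a = 1], where the sum is
    [S y = \sum_(i < p) (y ^ (p ^ t) + i) * (y ^ p + i) * (y + i)].  A cubic has
    zero sum over a prime field with at least 5 elements, so [S = 0] for [p >= 5].
    For [p = 3], [- S] is the linear map [y ^ (3 ^ t) + y ^ 3 + y], whose kernel
    is the prime field.  For [p = 2] and [n = 2 t], [S - 1] is
    [(y ^ (2 ^ t) + y) * (y ^ 2 + y + 1)], which vanishes too often.  For [p = 2]
    and [n = 2 t + 1] (the Welch exponent, treated by Dobbertin),
    [S y = Q (y ^ (2 ^ t) + y) + 1] where [y ^ (2 ^ t) + y] is 2-to-1 and
    [Q u = u ^ (2 ^ (t + 1) + 1) + u ^ 3 + u] is injective. *)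

Import GRing.Theory.

(** * Shifted power sums over the prime field *)

Section PowerSums.
Local Open Scope ring_scope.

Lemma frobenius_iter (R : comNzRingType) (p : nat) :
  p \in [pchar R] ->
  forall k, exists phi : {rmorphism R -> R}, forall x, phi x = x ^+ (p ^ k).
Proof.
move=> chR; elim=> [|k [phi phiE]]; first by exists idfun => x; rewrite expr1.
exists (pFrobenius_aut chR \o phi) => x /=.
by rewrite pFrobenius_autE phiE -exprM -expnSr.
Qed.

Lemma sum_Fp (V : nmodType) (p : nat) (G : nat -> V) :
  prime p -> \sum_(i : 'F_p) G i = \sum_(0 <= i < p) G i.
Proof. by move=> p_pr; rewrite -(big_mkord xpredT G) Fp_cast. Qed.

(** The sums of [i], [i ^ 2] and [i ^ 3] over [i < m] have denominators 2, 6 and 4, which the factor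
    12 clears. The right side vanishes as soon as [m%:R = 0]. *)
Lemma twelve_sum_cubic (R : comNzRingType) (A B C : R) (m : nat) :
  12%:R * (\sum_(0 <= i < m) (A + i%:R) * (B + i%:R) * (C + i%:R)) =
  m%:R * (12%:R * (A * B * C) + 6%:R * (m%:R - 1) * (A * B + A * C + B * C)
    + 2%:R * (m%:R - 1) * (2%:R * m%:R - 1) * (A + B + C)
    + 3%:R * m%:R * (m%:R - 1) ^+ 2).
Proof.
elim: m => [|m IHm]; first by rewrite big_geq // mulr0 mul0r.
by rewrite big_nat_recr //= mulrDr IHm -natr1; ring.
Qed.

Lemma card_frobenius_fix (F : finFieldType) (p : nat) :
  (1 < p)%N -> (#|[set z : F | z ^+ p == z]| <= p)%N.
Proof.
move=> p_gt1; set A := [set z | _].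
have sz : size ('X^p - 'X : {poly F}) = p.+1.
  by rewrite size_polyDl ?size_polyXn // size_polyN size_polyX.
rewrite cardE -ltnS -[X in (_ < X)%N]sz; apply: max_poly_roots.
- by rewrite -size_poly_eq0 sz.
- apply/allP=> z; rewrite mem_enum inE => /eqP zp.
  by rewrite rootE !hornerE zp subrr.
- exact: enum_uniq.
Qed.

Section Power.
Variables (F : finFieldType) (p d : nat).
Hypothesis p_pr : prime p.

Let S (y : F) := \sum_(0 <= i < p) (y + i%:R) ^+ d.

(** Putting [x = a * y] takes out a factor [a ^ d], which reduces everything to [a = 1]. A nonempty
    fibre of [S] then lies in a translate of the set of roots of [z ^ p = z], of which there are at
    most [p]. *)
Lemma GAPN_power_crit :
  (forall y y', S y = S y' -> (y' - y) ^+ p = y' - y) ->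
  GAPN p (fun x : F => x ^+ d).
Proof.
move=> critS a b a0; set A := [set x | _].
have SE x : x \in A -> a ^+ d * S (x / a) = b.
  rewrite inE => /eqP <-.
  rewrite (sum_Fp _ _ (fun i => (x + i%:R * a) ^+ d)) // mulr_sumr.
  by apply: eq_bigr => i _; rewrite -exprMn mulrDr mulrCA divff // mulr1 mulrC.
have [->|[x xA]] := set_0Vmem A; first by rewrite cards0.
apply: leq_trans (card_frobenius_fix F _ (prime_gt1 p_pr)).
have inj_f : injective (fun z => x + a * z) by move=> z z' /addrI /(mulfI a0).
rewrite -[X in (_ <= X)%N](card_imset _ inj_f).
apply/subset_leq_card/subsetP => x' x'A.
apply/imsetP; exists (x' / a - x / a); last by field.
rewrite inE; apply/eqP/critS.
by apply: (mulfI (expf_neq0 d a0)); rewrite !SE.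
Qed.

Lemma GAPN_power_fiber (b : F) :
  GAPN p (fun x : F => x ^+ d) -> (#|[set y | S y == b]| <= p)%N.
Proof.
move=> /(_ 1 b (oner_neq0 _)); congr (_ <= _)%N; apply: eq_card => y.
rewrite !inE (sum_Fp _ _ (fun i => (y + i%:R * 1) ^+ d)) //.
by congr (_ == _); apply: eq_bigr => i _; rewrite mulr1.
Qed.

End Power.

End PowerSums.

(** * Injectivity of the Welch map in characteristic 2 *)

Section Char2.
Local Open Scope ring_scope.
Variable F : fieldType.
Hypothesis ch2 : 2 \in [pchar F].

Let two0 : 2%:R = 0 :> F.
Proof. exact: pcharf0. Qed.

Lemma char2_sqr_add1 (x : F) : x ^+ 2 + 1 = 0 -> x = 1.
Proof.
move=> x2; apply/eqP; rewrite -subr_eq0 -sqrf_eq0.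
rewrite (_ : _ ^+ 2 = x ^+ 2 + 1 - 2%:R * x); last by ring.
by rewrite x2 two0 mul0r subr0.
Qed.

Lemma idem_field (x : F) : x ^+ 2 = x -> x = 0 \/ x = 1.
Proof.
move=> /eqP; rewrite -subr_eq0 (_ : _ - _ = x * (x - 1)); last by ring.
by rewrite mulf_eq0 subr_eq0 => /orP[] /eqP ->; [left | right].
Qed.

(* A collision [x' = x + u] with [x = u z] is an affine relation E1 between
   [k = sigma z + z + 1] and [K = sigma k]; as [sigma K = k ^ 2], eliminating [K]
   with E2 = sigma E1 gives a quadratic in [k].  With [r = sigma u / u] and
   [s = sigma r], so that [u = r s], it splits as E3, and applying [sigma] to
   either root forces [r = 1]. *)
Lemma welch_injective (sigma : {rmorphism F -> F}) :
  (forall x, sigma (sigma x) = x ^+ 2) ->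
  injective (fun x => sigma x * x + x ^+ 3 + x).
Proof.
move=> ss x x' E; apply/eqP/negPn/negP => neq_x.
pose u := x' - x; have u0 : u != 0 by rewrite subr_eq0 eq_sym.
pose r := sigma u / u; pose s := sigma r.
have su0 : sigma u != 0 by rewrite fmorph_eq0.
have r0 : r != 0 by rewrite mulf_neq0 ?invr_eq0.
have s0 : s != 0 by rewrite fmorph_eq0.
have uE : u = r * s by rewrite /s rmorphM fmorphV /= ss /r; field; rewrite u0 su0.
have srs : sigma s = r ^+ 2 by rewrite /s ss.
pose z := x / u; pose Z := sigma z.
have xE : x = r * s * z by rewrite -uE /z mulrC divfK.
have x'E : x' = r * s * (z + 1).
  by rewrite mulrDr -xE mulr1 -uE /u addrC subrK.
have srE : sigma r = s by [].
have szE : sigma z = Z by [].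
clearbody z Z s r.
pose k := Z + z + 1; pose K := z ^+ 2 + Z + 1.
have skE : sigma k = K by rewrite /k !rmorphD rmorph1 /= szE -{1}szE ss.
have sKE : sigma K = k ^+ 2.
  rewrite /K !rmorphD rmorphXn rmorph1 /= -[Z]szE ss szE.
  (* [ring] does not know the characteristic, so here and below the vanishing multiples of 2 or 3
     are written out. *)
  have -> : k ^+ 2 = Z ^+ 2 + z ^+ 2 + 1 + 2%:R * (Z * z + Z + z).
    by rewrite /k; ring.
  by rewrite two0 mul0r addr0.
have kE : k = Z + z + 1 by [].
have KE : K = z ^+ 2 + Z + 1 by [].
clearbody k K.
have E1 : r ^+ 2 * s * k + r ^+ 2 * s ^+ 2 * (k + K + 1) + 1 = 0.
  apply: (mulfI (mulf_neq0 r0 s0)); rewrite mulr0.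
  move/esym/eqP: E; rewrite -subr_eq0 => /eqP /=; rewrite x'E xE.
  rewrite !rmorphM !rmorphD !rmorph1 /= srs srE szE => E.
  rewrite -[RHS]addr0 -[X in _ = X + _]E.
  rewrite -[X in _ = _ + X](mul0r (r ^+ 3 * s ^+ 3 * (Z - z ^+ 2 - z + 1))) -two0.
  by rewrite kE KE; ring.
have E2 : s ^+ 2 * r ^+ 2 * K + s ^+ 2 * r ^+ 4 * (K + k ^+ 2 + 1) + 1 = 0.
  have := congr1 sigma E1.
  rewrite !rmorphD !rmorphM ?rmorphXn !rmorphD ?rmorph1 rmorph0 /= skE sKE srs srE.
  by move=> <-; ring.
have E3 : (s * k + s + 1) * (r ^+ 2 * s * k + s + 1) = 0.
  apply: (mulIf (expf_neq0 2 r0)); rewrite mul0r.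
  have -> : (s * k + s + 1) * (r ^+ 2 * s * k + s + 1) * r ^+ 2 =
      (s ^+ 2 * r ^+ 2 * K + s ^+ 2 * r ^+ 4 * (K + k ^+ 2 + 1) + 1)
    + (1 + r ^+ 2) * (r ^+ 2 * s * k + r ^+ 2 * s ^+ 2 * (k + K + 1) + 1)
    + 2%:R * (r ^+ 2 * s - K * r ^+ 2 * s ^+ 2 - K * r ^+ 4 * s ^+ 2
              - r ^+ 4 * s ^+ 2 - 1) by ring.
  by rewrite E1 E2 two0 mulr0 mul0r !addr0.
have E4 : (r ^+ 2 + 1) * (s ^+ 2 + 1) = 0.
  move/eqP: E3; rewrite mulf_eq0 => /orP[] /eqP C.
    have D : r ^+ 2 * K + r ^+ 2 + 1 = 0.
      by have := congr1 sigma C; rewrite !rmorphD rmorphM rmorph1 rmorph0 /= skE srs.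
    have -> : (r ^+ 2 + 1) * (s ^+ 2 + 1) =
        (r ^+ 2 * s * k + r ^+ 2 * s ^+ 2 * (k + K + 1) + 1)
      + (r ^+ 2 + r ^+ 2 * s) * (s * k + s + 1) + s ^+ 2 * (r ^+ 2 * K + r ^+ 2 + 1)
      + 2%:R * (- r ^+ 2 * s ^+ 2 - k * r ^+ 2 * s - k * r ^+ 2 * s ^+ 2
                - K * r ^+ 2 * s ^+ 2 - r ^+ 2 * s) by ring.
    by rewrite E1 C D two0 !mulr0 mul0r !addr0.
  have D : s ^+ 2 * r ^+ 2 * K + r ^+ 2 + 1 = 0.
    have := congr1 sigma C.
    by rewrite !rmorphD !rmorphM ?rmorphXn rmorph1 rmorph0 /= skE srs srE.
  have -> : (r ^+ 2 + 1) * (s ^+ 2 + 1) =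
      (r ^+ 2 * s * k + r ^+ 2 * s ^+ 2 * (k + K + 1) + 1)
    + (1 + s) * (r ^+ 2 * s * k + s + 1) + (s ^+ 2 * r ^+ 2 * K + r ^+ 2 + 1)
    + 2%:R * (- 1 - k * r ^+ 2 * s - k * r ^+ 2 * s ^+ 2
              - K * r ^+ 2 * s ^+ 2 - s) by ring.
  by rewrite E1 C D two0 !mulr0 mul0r !addr0.
have r1 : r = 1.
  move/eqP: E4; rewrite mulf_eq0 => /orP[] /eqP /char2_sqr_add1 // s1.
  by apply: (fmorph_inj sigma); rewrite srE rmorph1.
have s1 : s = 1 by rewrite -srE r1 rmorph1.
(* With [r = s = 1], E1 reduces to [K = 0], so [k = 0]. Then [K - k = z ^ 2 - z] puts [z] in the
   prime field, where [sigma z = z] gives [k = 1], a contradiction. *)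
have K0 : K = 0.
  move: E1; rewrite r1 s1 => <-.
  by rewrite -[LHS]addr0 -[X in _ + X = _](mul0r (k + 1)) -two0; ring.
have k0 : k = 0 by apply: (fmorph_inj sigma); rewrite rmorph0 skE.
have zz : z ^+ 2 = z.
  by apply/eqP; rewrite -subr_eq0; apply/eqP; rewrite -[RHS]subr0 -{1}K0 -k0 kE KE; ring.
have Zz : Z = z by rewrite -szE; case: (idem_field _ zz) => ->; rewrite ?rmorph0 ?rmorph1.
move/eqP: k0; rewrite kE Zz (_ : _ + _ = 2%:R * z + 1); last by ring.
by rewrite two0 mul0r add0r oner_eq0.
Qed.

End Char2.

(** * Splitting the exponent; characteristic at least 5 *)

Section Main.
Local Open Scope ring_scope.
Variables (F : finFieldType) (p : nat).
Hypothesis chF : p \in [pchar F].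

(** Raising to the power [p ^ t] or [p] is additive and fixes each [i%:R]. *)
Lemma shifted_power_sum (t : nat) (phi : {rmorphism F -> F}) (y : F) :
  (forall x, phi x = x ^+ (p ^ t)) ->
  \sum_(0 <= i < p) (y + i%:R) ^+ (p ^ t + p + 1) =
  \sum_(0 <= i < p) (phi y + i%:R) * (y ^+ p + i%:R) * (y + i%:R).
Proof.
move=> phiE; apply: eq_bigr => i _.
rewrite !exprD expr1 -phiE -pFrobenius_autE !rmorphD !rmorph_nat /=.
by rewrite pFrobenius_autE.
Qed.

(** As 12 is invertible, the sum vanishes identically, and its fibre over 0 is all of [F]. *)
Lemma GAPN_ge5 (t : nat) :
  (3 < p)%N -> GAPN p (fun x : F => x ^+ (p ^ t + p + 1)) -> (#|F| <= p)%N.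
Proof.
move=> p_gt3 /(GAPN_power_fiber _ _ _ (pcharf_prime chF) 0).
congr (_ <= _)%N; apply: eq_card => y; rewrite !inE.
have [phi phiE] := frobenius_iter _ _ chF t.
have n12 : 12%:R != 0 :> F.
  rewrite -(dvdn_pcharf chF); apply: contraL p_gt3 => p12.
  have : p \in primes 12 by rewrite mem_primes p12 (pcharf_prime chF).
  by rewrite !inE => /orP[] /eqP ->.
rewrite (shifted_power_sum _ _ _ phiE); apply/eqP/(mulfI n12).
by rewrite twelve_sum_cubic (pcharf0 chF) mul0r mulr0.
Qed.

End Main.

(** * Characteristic 3 *)

Section Char3.
Local Open Scope ring_scope.
Variables (F : finFieldType) (n : nat).
Hypothesis cardF : #|F| = (3 ^ n)%N.

Let ch3 : 3 \in [pchar F].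
Proof. exact: card_finPcharP cardF _. Qed.

Let three0 : 3%:R = 0 :> F.
Proof. exact: pcharf0. Qed.

(** With [f] the cubing map, [phi z = - (f z + z)], hence [phi (phi z)] is [(f + 1) ^ 2] applied to
    [z]. Since [phi] twice is the inverse of [f] for odd [n] and the identity for even [n], [z] is
    killed by [f (f + 1) ^ 2 - 1 = (f - 1) (f ^ 2 + 1)], respectively by
    [(f + 1) ^ 2 - 1 = f (f - 1)]. *)
Lemma trinomial_kernel (z : F) :
  z ^+ (3 ^ half_exp n) + z ^+ 3 + z = 0 -> z ^+ 3 = z.
Proof.
have [phi phiE] := frobenius_iter _ _ ch3 (half_exp n).
pose f : {rmorphism F -> F} := pFrobenius_aut ch3.
have fE x : f x = x ^+ 3 by [].
have phif x : phi (f x) = f (phi x) by rewrite !fE rmorphXn.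
clearbody f.
rewrite -phiE -fE => E; have {E} pz : phi z = - (f z + z).
  by apply/eqP; rewrite -addr_eq0 addrA E.
have ppz : phi (phi z) = f (f z) + (f z + f z) + z.
  rewrite {1}pz rmorphN rmorphD /= phif pz rmorphN rmorphD /=; ring.
have phi2 x : phi (phi x) = x ^+ (3 ^ (half_exp n).*2).
  by rewrite !phiE -exprM -expnD addnn.
have zn : z ^+ (3 ^ n) = z by rewrite -cardF expf_card.
apply/eqP; rewrite -subr_eq0; have [n_odd|n_even] := boolP (odd n).
  have nE : n = ((half_exp n).*2).+1.
    rewrite /half_exp n_odd divn2 subn1 -[LHS]odd_double_half n_odd.
    by case: n n_odd => //= m /negbTE; rewrite uphalf_half => ->.
  pose w := f z - z; have wE : w = f z - z by [].
  have w9 : w ^+ 9 = - w.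
    have : f (phi (phi z)) = z by rewrite fE phi2 -exprM -expnSr -nE.
    rewrite ppz !rmorphD /= => E.
    rewrite -[9%N]/(3 * 3)%N exprM -!fE wE !rmorphB /=.
    apply/eqP; rewrite -subr_eq0 -{4}E; apply/eqP.
    rewrite -[RHS](mul0r (- f (f z))) -three0; ring.
  clearbody w.
  (* As [w ^ (3 ^ n) = w], the sign in [w ^ (9 ^ t) = w] or [- w], with [n = 2 t + 1], gives
     [w ^ 3 = w] or [- w]. Either way [w ^ 9 = w], so [w = - w] and [w = 0]. *)
  have w_pow m : w ^+ (9 ^ m) = w \/ w ^+ (9 ^ m) = - w.
    elim: m => [|m [] IHm]; first by left; rewrite expr1.
      by right; rewrite expnSr exprM IHm.
    by left; rewrite expnSr exprM IHm exprNn w9 -signr_odd expr1 mulrNN mul1r.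
  have w3 : w ^+ 3 = w \/ w ^+ 3 = - w.
    have wn : w = (w ^+ 3) ^+ (9 ^ half_exp n).
      by rewrite -exprM -[9%N]/(3 ^ 2)%N -expnM mul2n -expnS -nE -cardF expf_card.
    rewrite -exprM mulnC exprM in wn.
    case: (w_pow (half_exp n)) => E; move: wn; rewrite E => {2 4}->; first by left.
    by right; rewrite exprNn -signr_odd expr1 mulN1r opprK.
  have : w = - w.
    rewrite -w9 -[9%N]/(3 * 3)%N exprM.
    have cubeN : (- w) ^+ 3 = - w ^+ 3 by ring.
    by case: w3 => E; rewrite E; [rewrite E | rewrite cubeN E opprK].
  move=> ww; apply/eqP; rewrite -wE.
  have -> : w = 3%:R * w - (w - - w) by ring.
  by rewrite three0 mul0r -ww !subrr.
have nE : n = (half_exp n).*2.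
  by rewrite /half_exp (negPf n_even) divn2 -[LHS]odd_double_half (negPf n_even).
have E : f (f z) + (f z + f z) + z = z by rewrite -ppz phi2 -nE.
have -> : (f z - z == 0) = ((f z - z) ^+ 3 == 0) by rewrite expf_eq0.
rewrite -fE; apply/eqP.
rewrite rmorphB /= -[RHS](subrr z) -[X in _ = X - _]E.
by rewrite -[LHS]addr0 -[X in _ + X = _](mul0r (f z)) -three0; ring.
Qed.

Lemma GAPN_char3 : GAPN 3 (fun x : F => x ^+ (3 ^ half_exp n + 3 + 1)).
Proof.
apply: GAPN_power_crit => // y y'.
have [phi phiE] := frobenius_iter _ _ ch3 (half_exp n).
rewrite !(shifted_power_sum _ _ ch3 _ _ _ phiE) => E.
apply: trinomial_kernel.
rewrite -phiE rmorphB /= -(pFrobenius_autE ch3) rmorphB /= !pFrobenius_autE.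
have sumE x : \sum_(0 <= i < 3) (phi x + i%:R) * (x ^+ 3 + i%:R) * (x + i%:R) =
    - (phi x + x ^+ 3 + x) + 3%:R * (phi x * x ^+ 3 * x
      + phi x * x ^+ 3 + phi x * x + x ^+ 3 * x
      + 2%:R * (phi x + x ^+ 3 + x) + 3%:R).
  by rewrite !big_nat_recr //= big_geq //; ring.
move: E; rewrite !sumE three0 !mul0r !addr0 => /oppr_inj E.
rewrite [X in X = _](_ : _ = phi y' + y' ^+ 3 + y' - (phi y + y ^+ 3 + y)); last by ring.
by rewrite E subrr.
Qed.

End Char3.

(** * Characteristic 2, by the parity of [n] *)

Section FiniteChar2.
Local Open Scope ring_scope.
Variables (F : finFieldType) (n : nat).
Hypotheses (n_gt0 : (0 < n)%N) (cardF : #|F| = (2 ^ n)%N).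

Let ch2 : 2 \in [pchar F].
Proof. exact: card_finPcharP cardF _. Qed.

Let two0 : 2%:R = 0 :> F.
Proof. exact: pcharf0. Qed.

Lemma GAPN_char2_odd :
  odd n -> GAPN 2 (fun x : F => x ^+ (2 ^ half_exp n + 2 + 1)).
Proof.
move=> n_odd; set t := half_exp n.
have nE : n = (t.*2).+1.
  rewrite /t /half_exp n_odd divn2 subn1 -[LHS]odd_double_half n_odd.
  by case: n n_odd => //= m /negbTE; rewrite uphalf_half => ->.
have fn (x : F) : x ^+ (2 ^ (t.*2).+1) = x by rewrite -nE -cardF expf_card.
apply: GAPN_power_crit => // y y'.
have [phi phiE] := frobenius_iter _ _ ch2 t.
(* The exponent [t + 1] makes [sigma] a square root of the Frobenius map, as [2 (t + 1) = n + 1],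
   and the inverse of [phi], as [t + (t + 1) = n]. *)
have [sigma sigmaE] := frobenius_iter _ _ ch2 t.+1.
have ss x : sigma (sigma x) = x ^+ 2.
  by rewrite !sigmaE -exprM -expnD addnS addSn addnn expnSr exprM fn.
have sphi x : sigma (phi x) = x.
  by rewrite sigmaE phiE -exprM -expnD addnS addnn fn.
have sphi2 x : sigma x = phi x ^+ 2 by rewrite sigmaE phiE expnSr exprM.
rewrite !(shifted_power_sum _ _ ch2 _ _ _ phiE).
have sumE x : \sum_(0 <= i < 2) (phi x + i%:R) * (x ^+ 2 + i%:R) * (x + i%:R) =
    sigma (phi x + x) * (phi x + x) + (phi x + x) ^+ 3 + (phi x + x) + 1
    + 2%:R * (phi x * x ^+ 3 - phi x * x ^+ 2 - phi x ^+ 3 - 2%:R * phi x ^+ 2 * x).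
  by rewrite rmorphD /= sphi sphi2 !big_nat_recr //= big_geq //; ring.
rewrite !sumE two0 !mul0r !addr0 => /addIr /(welch_injective _ ch2 _ ss) E.
have pz : phi (y' - y) = y' - y.
  rewrite rmorphB /=; apply/eqP; rewrite -subr_eq0.
  rewrite (_ : _ - _ = phi y' + y' - (phi y + y) - 2%:R * (y' - y)); last by ring.
  by rewrite E two0 mul0r subrr subr0.
by rewrite -[RHS]sphi pz sphi2 pz.
Qed.

(** For even [n], [phi] is an involution and the fibre over 1 contains 0, 1 and all fixed points of
    [phi]. The bound leaves only 0 and 1, so traces and norms [phi x + x] and [phi x * x] lie there
    too. This forces every [x] into the fibre, although [F] has more than 2 elements. *)
Lemma GAPN_char2_odd_conv :
  GAPN 2 (fun x : F => x ^+ (2 ^ half_exp n + 2 + 1)) -> odd n.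
Proof.
move=> /(GAPN_power_fiber _ 2 _ isT 1) G; apply/negPn/negP => n_even.
move: G; set t := half_exp n; set A := [set y | _] => cardA.
have nE : n = t.*2.
  by rewrite /t /half_exp (negPf n_even) divn2 -[LHS]odd_double_half (negPf n_even).
have [phi phiE] := frobenius_iter _ _ ch2 t.
have pp x : phi (phi x) = x by rewrite !phiE -exprM -expnD addnn -nE -cardF expf_card.
have memA x : (x \in A) = ((phi x + x) * (x ^+ 2 + x + 1) == 0).
  rewrite inE (shifted_power_sum _ _ ch2 _ _ _ phiE) !big_nat_recr //= big_geq //.
  rewrite -subr_eq0 (_ : _ - 1 = (phi x + x) * (x ^+ 2 + x + 1)
    + 2%:R * (phi x * x ^+ 3)); last by ring.
  by rewrite two0 mul0r addr0.
have A01 x : x \in A -> x = 0 \/ x = 1.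
  move=> xA; have [|x0] := eqVneq x 0; first by left.
  have [|x1] := eqVneq x 1; first by right.
  exfalso; move: cardA; apply/negP.
  have sub : [set x; 0; 1] \subset A.
    rewrite !subUset !sub1set xA !memA rmorph0 rmorph1 addr0 mul0r.
    by rewrite -[1 + 1]/(2%:R) two0 mul0r eqxx.
  rewrite -ltnNge; apply: leq_trans (subset_leq_card sub).
  by rewrite setUC cardsU1 !inE cards2 x0 oner_eq0 orbF eq_sym x1.
have fix01 x : phi x = x -> x = 0 \/ x = 1.
  by move=> px; apply: A01; rewrite memA px -mulr2n -mulr_natl two0 !mul0r.
(* [x] is a root of [X^2 + (phi x + x) X + phi x * x], whose coefficients are fixed
   by [phi] and hence, by the bound on [A], equal to 0 or 1. *)
have allA x : x \in A.
  rewrite memA; have : phi (phi x + x) = phi x + x by rewrite rmorphD /= pp addrC.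
  move=> /fix01[-> | tr1]; first by rewrite mul0r.
  have : phi (phi x * x) = phi x * x by rewrite rmorphM /= pp mulrC.
  move=> /fix01[/eqP | nm1].
    rewrite mulf_eq0 fmorph_eq0 orbb => /eqP x0.
    by rewrite x0 rmorph0 addr0 mul0r.
  rewrite (_ : x ^+ 2 + x + 1 = 0) ?mulr0 //.
  rewrite -[in _ + 1]nm1 -[x in _ + x + _]mul1r -tr1 -[RHS](mul0r (x * (phi x + x))).
  by rewrite -two0; ring.
have : (#|F| <= 2)%N.
  by apply: leq_trans cardA; apply/subset_leq_card/subsetP => x _; apply: allA.
rewrite cardF -{2}[2%N]expn1 leq_exp2l // nE leqNgt.
by have: (0 < t.*2)%N; [rewrite -nE | case: (t)].
Qed.

End FiniteChar2.

(** If [n = 1], the field has [p] elements and every function is GAPN, so the equivalence would fail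
    for [p >= 5]; [n1_p_le3] excludes exactly these cases. *)
Theorem proposition2p5 (p n : nat) (F : finFieldType)
  (p_prime : prime p) (n_ge1 : 1 <= n) (n1_p_le3 : n = 1 -> p <= 3)
  (cardF : #|F| = p ^ n) :
  GAPN p (fun x : F => (x ^+ (p ^ half_exp n + p + 1))%R) <->
  ((p = 2 /\ odd n) \/ p = 3).
Proof.
split=> [G | [[p2 n_odd] | p3]]; last 2 first.
- by rewrite p2 in cardF *; apply: GAPN_char2_odd.
- by rewrite p3 in cardF *; apply: GAPN_char3.
have [p_gt3|] := ltnP 3 p.
  have := GAPN_ge5 _ _ (card_finPcharP cardF p_prime) _ p_gt3 G.
  rewrite cardF -{2}[p]expn1 leq_exp2l ?prime_gt1 // => n_le1.
  by have := n1_p_le3 (anti_leq (introT andP (conj n_le1 n_ge1))); rewrite leqNgt p_gt3.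
case: p p_prime G cardF {n1_p_le3} => [|[|[|[|]]]] //; last by right.
by move=> _ G cardF _; left; split=> //; apply: (GAPN_char2_odd_conv _ _ n_ge1 cardF).
Qed.
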